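(* Let $K_n^{r}$ be the complete $r$-uniform hypergraph on $n$ vertices, and let $C_\tau$ denote the transversal coalition number. Then: (i) $C_\tau(K_n^{r})=n$ if $n=r$ or $n=r+1$; (ii) $C_\tau(K_n^{r})=r+1$ if $r\geq 3$ and $n>r+1$.
   Context: A hypergraph $H=(U,\mathcal{E})$ consists of a finite vertex set $U$ and a family $\mathcal{E}$ of subsets of $U$ called (hyper)edges; it is $r$-uniform if every edge has exactly $r$ vertices. The complete $r$-uniform hypergraph $K_n^r$ has $n$ vertices and its edges are all the $r$-element subsets of the vertex set. A transversal of $H$ is a set $T\subseteq U$ with $T\cap e\neq\emptyset$ for every $e\in\mathcal{E}$. Two disjoint sets $U_1,U_2\subseteq U$ form a transversal coalition if neither $U_1$ nor $U_2$ is a transversal of $H$ but $U_1\cup U_2$ is a transversal of $H$. A transversal coalition partition of $H$ is a partition $\varphi=\{U_1,\dots,U_k\}$ of $U$ into nonempty sets such that each $U_i$ either is a singleton that is a transversal of $H$, or is not a transversal of $H$ and forms a transversal coalition with some other (non-transversal) set $U_j\in\varphi$. The transversal coalition number $C_\tau(H)$ is the maximum $k$ for which $H$ has a transversal coalition partition with $k$ parts. *)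

(* Defs.v *)
From mathcomp Require Import all_boot.

Set Implicit Arguments.
Unset Strict Implicit.
Unset Printing Implicit Defensive.

(* A hypergraph on the finite vertex type U is given by its set of edges. *)
Definition hypergraph (U : finType) : Type := {set {set U}}.

Definition complete_hypergraph (n r : nat) : hypergraph 'I_n :=
  [set e : {set 'I_n} | #|e| == r].

Section TransversalCoalition.

Variables (U : finType) (H : hypergraph U).
Implicit Types (T A B : {set U}) (P : {set {set U}}).

Definition transversal_of T : bool :=
  [forall e in H, T :&: e != set0].

Definition transversal_coalition A B : bool :=
  [&& [disjoint A & B], ~~ transversal_of A, ~~ transversal_of B
    & transversal_of (A :|: B)].

(* [partition] already requires the parts to be nonempty. The coalition partner
   of A is automatically another part, being disjoint from the nonempty A. *)
Definition coalition_partition P : bool :=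
  partition P [set: U] &&
  [forall A in P,
     ((#|A| == 1) && transversal_of A)
     || (~~ transversal_of A && [exists B in P, transversal_coalition A B])].

(* The maximum is 0 by convention when there is no coalition partition; a
   positive value is always attained by an actual coalition partition. *)
Definition coalition_number : nat :=
  \max_(P : {set {set U}} | coalition_partition P) #|P|.

End TransversalCoalition.

(* Main.v *)
(** A set is a transversal of K_n^r exactly when it has more than n - r elements.
    A coalition therefore uses at least n - r + 1 vertices, which leaves at most
    r - 1 other parts. Conversely, one part with n - r vertices together with r
    singletons is a coalition partition; when n = r, all singletons are
    transversals. *)

Require Import Defs.
From mathcomp Require Import all_boot.

(** An edge missed by [T] is an [r]-subset of [~: T], and one exists iff [r <= n - #|T|]. *)
Lemma transversal_complete n r (T : {set 'I_n}) :
  transversal_of (complete_hypergraph n r) T = (n < #|T| + r).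
Proof.
apply/idP/idP => [/forall_inP trT | ltn].
  rewrite ltnNge; apply/negP => le_n.
  have : 0 < #|[set e : {set 'I_n} | e \subset ~: T & #|e| == r]|.
    rewrite cards_draws bin_gt0 -(leq_add2l #|T|) cardsC card_ord.
    exact: le_n.
  case/card_gt0P => e; rewrite inE => /andP[sub_e re].
  have := trT e; rewrite inE => /(_ re).
  by rewrite setI_eq0 disjoint_sym disjoints_subset sub_e.
apply/forall_inP => e; rewrite inE => /eqP re; apply: contraTneq ltn => TIe.
rewrite -leqNgt -re -cardsUI TIe cards0 addn0.
by rewrite -[leqRHS](card_ord n) max_card.
Qed.

(** Nonempty sets have size at least 1. Stating this for a predicate lets it bound the parts that
    remain once a coalition pair is split off. *)
Lemma leq_sum_card (T : finType) (Q : pred {set T}) :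
  ~~ Q set0 -> \sum_(A | Q A) 1 <= \sum_(A | Q A) #|A|.
Proof.
move=> Q0; apply: leq_sum => A QA.
by rewrite card_gt0; apply: contraNneq Q0 => <-.
Qed.

Lemma leq_card_partition (T : finType) (P : {set {set T}}) (D : {set T}) :
  partition P D -> #|P| <= #|D|.
Proof.
move=> partP; rewrite (card_partition partP) -sum1_card.
by have /and3P[_ _ P0] := partP; apply: leq_sum_card.
Qed.

(** Source of both lower bounds: [B] will have [n - r] vertices when [r < n], and a single vertex
    when [n = r]. *)
Definition isolating_partition {T : finType} (B : {set T}) : {set {set T}} :=
  B |: [set [set x] | x in ~: B].

Lemma isolating_partitionP (T : finType) (B : {set T}) :
  B != set0 -> partition (isolating_partition B) [set: T].
Proof.
move=> B0; apply/and3P; split.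
- rewrite eqEsubset subsetT; apply/subsetP => x _; apply/bigcupP.
  have [xB | xNB] := boolP (x \in B); first by exists B; rewrite ?setU11.
  exists [set x]; rewrite ?set11 //; apply/setU1P; right.
  by apply/imsetP; exists x; rewrite ?inE.
- apply/trivIsetP => A C /setU1P[->|/imsetP[x xB ->]] /setU1P[->|/imsetP[y yB ->]].
  + by rewrite eqxx.
  + by rewrite disjoint_sym disjoints1 -in_setC.
  + by rewrite disjoints1 -in_setC.
  + by rewrite disjoints1 inE; apply: contraNN => /eqP->.
- rewrite !inE eq_sym negb_or B0; apply/imsetP => -[x _ /setP/(_ x)].
  by rewrite !inE eqxx.
Qed.

Lemma card_isolating_partition (T : finType) (B : {set T}) :
  B != set0 -> #|isolating_partition B| = #|~: B|.+1.
Proof.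
move=> B0; rewrite cardsU1 (card_imset _ set1_inj); case: imsetP => //= -[x].
by move=> xB defB; rewrite defB !inE eqxx in xB.
Qed.

(** Serves both (ii) and the case [n = r.+1] of (i), where [r.+1] is [n]. *)
Lemma coalition_number_complete n r :
  0 < r -> r < n -> coalition_number (complete_hypergraph n r) = r.+1.
Proof.
move=> r_gt0 ltrn; apply/eqP; rewrite eqn_leq; apply/andP; split.
  apply/bigmax_leqP => P /andP[partP /forall_inP coalP].
  have /and3P[/eqP covP _ P0] := partP.
  have [A PA] : exists A, A \in P.
    have : Ordinal ltrn \in cover P by rewrite covP inE.
    by case/bigcupP => A PA _; exists A.
  (* A singleton transversal would give [n < 1 + r], against [r < n], so [A] has a coalition
     partner. *)
  have := coalP A PA; rewrite transversal_complete => /orP[/andP[/eqP->]|].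
    by rewrite add1n ltnS leqNgt ltrn.
  case/andP => _ /exists_inP[B PB /and4P[disAB _ _]].
  rewrite transversal_complete (cardsU A B) (eqP (_ : _ :&: _ == set0)) ?setI_eq0 //.
  rewrite cards0 subn0 => ltn.
  have neqBA : B != A.
    apply: contraTneq disAB => ->; rewrite -setI_eq0 setIid.
    by apply: contraNneq P0 => <-.
  (* With [A] and [B] split off, the other parts have total size [n - (#|A| + #|B|)], which is below
     [r] by [ltn]; hence there are fewer than [r] of them. *)
  have := card_partition partP; rewrite cardsT card_ord.
  rewrite (bigD1 A) //= (bigD1 B) ?PB //= addnA => def_n.
  rewrite -[#|P|]sum1_card (bigD1 A) //= (bigD1 B) ?PB //=.
  rewrite !add1n !ltnS; apply: leq_ltn_trans (leq_sum_card _ _ _) _.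
    by rewrite /= (negPf P0).
  by rewrite -(ltn_add2l (#|A| + #|B|)) -def_n.
(* The size [n - r] is the largest of a non-transversal, so any one further vertex completes [B] to
   a transversal. *)
pose B := [set i : 'I_n | r <= i].
have cardCB : #|~: B| = r.
  have -> : ~: B = [set widen_ord (ltnW ltrn) i | i in 'I_r].
    apply/setP => i; rewrite !inE -ltnNge; apply/idP/imsetP => [ltir | [j _ ->]].
      by exists (Ordinal ltir) => //; apply: val_inj.
    exact: (ltn_ord j).
  by rewrite card_imset ?card_ord // => i j /(congr1 val) /= /val_inj.
have cardB : #|B| + r = n by rewrite -cardCB cardsC card_ord.
have B0 : B != set0.
  by rewrite -card_gt0 -(ltn_add2r r) cardB.
have coal_B x : x \in ~: B ->
    transversal_coalition (complete_hypergraph n r) B [set x].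
  move=> xB; apply/and4P; split.
  - by rewrite disjoint_sym disjoints1 -in_setC.
  - by rewrite transversal_complete cardB ltnn.
  - by rewrite transversal_complete cards1 add1n ltnS -ltnNge.
  - by rewrite transversal_complete setUC cardsU1 -in_setC xB add1n addSn cardB.
have coal_sym x : x \in ~: B ->
    transversal_coalition (complete_hypergraph n r) [set x] B.
  move=> /coal_B; rewrite /transversal_coalition disjoint_sym setUC.
  by case/and4P => -> -> -> ->.
rewrite -{1}cardCB -(card_isolating_partition _ _ B0).
apply: leq_bigmax_cond.
apply/andP; split; first exact: isolating_partitionP.
apply/forall_inP => A /setU1P[-> | /imsetP[x xB ->]]; apply/orP; right.
  (* Here [0 < r] matters: it provides a vertex outside [B], hence a partner for [B]. *)
  have /card_gt0P[x xB] : 0 < #|~: B| by rewrite cardCB.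
  have /and4P[_ nB _ _] := coal_B x xB; rewrite nB /=; apply/exists_inP.
  by exists [set x]; rewrite ?coal_B //; apply/setU1P; right; apply: imset_f.
have /and4P[_ _ nx _] := coal_B x xB; rewrite nx /=; apply/exists_inP.
by exists B; rewrite ?coal_sym ?setU11.
Qed.

Lemma coalition_number_complete_diag n :
  0 < n -> coalition_number (complete_hypergraph n n) = n.
Proof.
case: n => // n _; apply/eqP; rewrite eqn_leq; apply/andP; split.
  apply/bigmax_leqP => P /andP[/leq_card_partition].
  by rewrite cardsT card_ord.
(* Isolating around a one-point set gives the partition into all singletons. *)
have B0 : [set ord0 : 'I_n.+1] != set0 by rewrite -card_gt0 cards1.
have cardP : #|isolating_partition [set ord0 : 'I_n.+1]| = n.+1.
  by rewrite card_isolating_partition // -add1n -(cards1 (@ord0 n)) cardsC card_ord.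
rewrite -[leqLHS]cardP.
apply: leq_bigmax_cond.
apply/andP; split; first exact: isolating_partitionP.
apply/forall_inP => A PA; apply/orP; left.
have -> : #|A| == 1 by case/setU1P: PA => [->|/imsetP[x _ ->]]; rewrite cards1.
(* With [r = n], the criterion [n < #|A| + r] reduces to [A] being nonempty. *)
rewrite transversal_complete -[leqLHS]add1n leq_add2r card_gt0.
by case/setU1P: PA => [->|/imsetP[x _ ->]]; rewrite -card_gt0 cards1.
Qed.

Theorem theorem2 (n r : nat) (r_gt0 : 0 < r) :
  (n = r \/ n = r.+1 -> coalition_number (complete_hypergraph n r) = n)
  /\ (3 <= r -> r.+1 < n ->
      coalition_number (complete_hypergraph n r) = r.+1).
Proof.
split=> [[->|->] | _ /ltnW]; last exact: coalition_number_complete.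
  exact: coalition_number_complete_diag.
exact: coalition_number_complete.
Qed.
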